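(* Let $p>3$ be a prime. Then the following polynomial congruence holds in $\mathbb{Z}_{(p)}[t]$: \[ p\sum_{k=1}^{p-1} \frac{t^k}{k^3\binom{2k}{k}} \equiv \frac{1-\bigl(v_p(2-t)+t^p\bigr)\binom{2p}{p}^{-1}}{p^2}-\frac{1}{p}\sum_{k=1}^{p-1} \frac{v_{k}(2-t)}{k} \pmod{p^2}. \]
   Context: The Lucas polynomials $v_n(x)\in\mathbb{Z}[x]$ are defined by $v_0=2$, $v_1=x$, $v_n(x)=x\,v_{n-1}(x)-v_{n-2}(x)$ for $n>1$. $\mathbb{Z}_{(p)}$ denotes the rationals whose denominators are prime to $p$; for polynomials $A,B\in\mathbb{Q}[t]$, $A\equiv B\pmod{p^m}$ means that $A-B\in p^m\mathbb{Z}_{(p)}[t]$. *)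

(* Defs.v *)
From mathcomp Require Import all_boot all_order all_algebra.

Set Implicit Arguments.
Unset Strict Implicit.
Unset Printing Implicit Defensive.

Import GRing.Theory.
Local Open Scope ring_scope.

Fixpoint lucas (n : nat) : {poly int} :=
  match n with
  | 0 => 2%:R
  | 1 => 'X
  | (m.+1 as k).+1 => 'X * lucas k - lucas m
  end.

(* [lucas_at n q] is v_n(q) for q in Q[t]. *)
Definition lucas_at (n : nat) (q : {poly rat}) : {poly rat} :=
  map_poly intr (lucas n) \Po q.

(* The ring Z_(p), as a subset of Q; [denq] is the reduced denominator. *)
Definition Zloc (p : nat) : {pred rat} :=
  [pred x : rat | coprime p `|denq x|%N].

Definition polyQ_congr (p m : nat) (A B : {poly rat}) : Prop :=
  exists2 C : {poly rat}, C \is a polyOver (Zloc p) & A - B = p%:R ^+ m *: C.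

(* Main.v *)
(* Compare coefficients of t^k.  Write f = (p-1)!, W = binom(2p-1, p), H the
   harmonic number of index p-1, and R_k = prod_{0<i<k} (i^2 - p^2).  The
   expansion
     v_n(2-t) = sum_k (-1)^k (binom(n+k,2k) + binom(n+k-1,2k)) t^k
   makes sum_n v_n/n telescope for k > 0, and for 0 < k < p the difference of the
   two sides is
     (p ((k-1)!^2 - R_k) - k R_k (1/W - 1)) / (k (2k)!).
   Its numerator is divisible by p^3, since R_k = (k-1)!^2 mod p^2 and W = 1 mod p^3
   (Wolstenholme), while (2k)! contains p at most once.  For k >= p both sides
   vanish.  For k = 0 one needs f (W - 1) = 2 p f H mod p^4: this follows from
   G = prod_{0<j<p} (X - j), whose coefficients of X^2 and X^3 are divisible by p
   because G = X^(p-1) - 1 mod p, and which satisfies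
   G(p) = G(0) = f, G(-p) = f W, G'(0) = - f H. *)
Require Import Defs.
From mathcomp Require Import all_boot all_order all_algebra all_field.
From mathcomp Require Import ring zify.
Import GRing.Theory Num.Theory.
Local Open Scope ring_scope.

(** By Gauss, [denq x] divides [b]. Membership in Z_(p) thus reduces to exhibiting one cleared
    fraction, reduced or not. *)
Lemma Zloc_frac (p : nat) (x : rat) (a : int) (b : nat) :
  coprime p b -> x * b%:R = a%:~R -> x \in Zloc p.
Proof.
move=> co_pb xb_a; rewrite inE.
have : numq x * b%:Z = a * denq x.
  by apply: (@intr_inj rat); rewrite !rmorphM /= -xb_a mulrAC numqE.
move=> numE; have : (denq x %| numq x * b%:Z)%Z by rewrite numE dvdz_mull.
rewrite Gauss_dvdzr; last first.
  by rewrite coprimezE coprime_sym coprime_num_den.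
by rewrite dvdzE absz_nat => /coprime_dvdr->.
Qed.

(** * Coefficients of Lucas polynomials at 2 - t *)

Lemma lucas_at_rec (n : nat) (q : {poly rat}) :
  lucas_at n.+2 q = q * lucas_at n.+1 q - lucas_at n q.
Proof.
by rewrite /lucas_at [lucas n.+2]/= rmorphB rmorphM /= map_polyX
  comp_polyB comp_polyM comp_polyX.
Qed.

(** Pascal's rule applied twice; this is the recurrence v_(n+2) = (2 - t) v_(n+1) - v_n read on
    coefficients. *)
Lemma bin_second_difference (R : pzRingType) (m i : nat) :
  'C(m.+2, i.+2)%:R = 2 * 'C(m.+1, i.+2)%:R - 'C(m, i.+2)%:R + 'C(m, i)%:R :> R.
Proof.
apply/eqP; rewrite addrAC -subr_eq opprK -natrM -!natrD; apply/eqP; congr _%:R.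
rewrite !binS; lia.
Qed.

Lemma coef_lucas_at (n k : nat) :
  (lucas_at n (2%:R - 'X))`_k =
    (-1) ^+ k * ('C(n + k, 2 * k)%:R + 'C((n + k).-1, 2 * k)%:R).
Proof.
elim/ltn_ind: n k => -[|[|n]] IHn k.
(* At n = k = 0 the truncated predecessor makes both binomials 1, which yields v_0 = 2. *)
- rewrite /lucas_at /= rmorph_nat -polyC_natr comp_polyC coefC add0n.
  by case: k => [|k] //=; rewrite !bin_small ?mulr0 //; lia.
- rewrite /lucas_at /= map_polyX comp_polyX coefB coefX -polyC_natr coefC.
  case: k => [|[|k]] //=; rewrite !bin_small ?mulr0 ?subr0 //; lia.
- rewrite lucas_at_rec coefB mulrBl coefB mulr_natl coefMn coefXM !IHn //.
  case: k => [|k].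
    by rewrite /= muln0 !bin0 !mul1r.
  rewrite /= !addSn !addnS !mulnS /= exprS.
  rewrite (bin_second_difference _ (n + k).+1) (bin_second_difference _ (n + k)).
  ring.
Qed.

Lemma coef_lucas_at_div (n k : nat) : (0 < n)%N -> (0 < k)%N ->
  n%:R^-1 * (lucas_at n (2%:R - 'X))`_k =
    (-1) ^+ k / k%:R * ('C(n + k, 2 * k)%:R - 'C((n + k).-1, 2 * k)%:R).
Proof.
move=> n0 k0; rewrite coef_lucas_at.
have nz_n : n%:R != 0 :> rat by rewrite pnatr_eq0 -lt0n.
have nz_k : k%:R != 0 :> rat by rewrite pnatr_eq0 -lt0n.
(* For k > n the truncated difference n - k would be wrong, but then both binomials vanish. *)
have h : (n + k)%:R * 'C((n + k).-1, 2 * k)%:R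
       = (n%:R - k%:R) * 'C(n + k, 2 * k)%:R :> rat.
  rewrite -natrM mul_bin_down natrM.
  case: (leqP k n) => le_kn; last by rewrite bin_small ?mulr0 //; lia.
  by rewrite -natrB //; congr (_%:R * _); lia.
rewrite natrD in h.
apply: (mulfI nz_n); apply: (mulfI nz_k).
rewrite [LHS](_ : _ = (-1) ^+ k * (k%:R * ('C(n + k, 2 * k)%:R + 'C((n + k).-1, 2 * k)%:R)));
  last by field.
rewrite [RHS](_ : _ = (-1) ^+ k * (n%:R * ('C(n + k, 2 * k)%:R - 'C((n + k).-1, 2 * k)%:R)));
  last by field.
congr (_ * _); apply/subr0_eq.
by rewrite -(subrr ((n%:R - k%:R) * 'C(n + k, 2 * k)%:R)) -{1}h; ring.
Qed.

Lemma coef_sum_lucas_at (p k : nat) : (0 < p)%N -> (0 < k)%N ->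
  (\sum_(1 <= n < p) ((n%:R : rat)^-1 *: lucas_at n (2%:R - 'X)))`_k =
    (-1) ^+ k / k%:R * 'C((p + k).-1, 2 * k)%:R.
Proof.
move=> p0 k0; rewrite coef_sum.
under eq_big_nat => n /andP[n0 _] do rewrite coefZ coef_lucas_at_div //.
rewrite -big_distrr /=; congr (_ * _).
rewrite (telescope_sumr_eq (fun n => 'C((n + k).-1, 2 * k)%:R)) //.
by rewrite add1n /= (@bin_small k) ?subr0 //; lia.
Qed.

(** * Products of i^2 - p^2 *)

(** The factors p + j, ..., p - j are symmetric about p: pairing p + i with p - i gives -(i^2 -
    p^2). *)
Lemma falling_fact_symm (p j : nat) : (j < p)%N ->
  ((p + j) ^_ (2 * j).+1)%:R =
    (-1) ^+ j * p%:R * \prod_(1 <= i < j.+1) (i%:R ^+ 2 - p%:R ^+ 2) :> rat.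
Proof.
elim: j => [|j IHj] ltjp; first by rewrite big_geq // addn0 ffactn1 expr0 mul1r mulr1.
rewrite mulnS !addSn add0n addnS ffactSS ffactnSr natrM (natrM _ ((p + j) ^_ _)) IHj; last exact: ltnW.
rewrite (exprS _ j) (big_nat_recr j.+1) //=.
have -> : (p + j - (2 * j).+1 = p - j.+1)%N by lia.
rewrite natrB ?(ltnW ltjp) // -!natr1 natrD; ring.
Qed.

Lemma prod_sub_sqr (p j : nat) : exists r : int,
  (j`! ^ 2)%:R - \prod_(1 <= i < j.+1) (i%:R ^+ 2 - p%:R ^+ 2) = p%:R ^+ 2 * r.
Proof.
elim: j => [|j [r IHj]].
  by exists 0; rewrite big_geq // mulr0.
exists (r * (j.+1%:R ^+ 2 - p%:R ^+ 2) + (j`! ^ 2)%:R).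
rewrite big_nat_recr //= factS expnMn natrM.
have -> : \prod_(1 <= i < j.+1) (i%:R ^+ 2 - p%:R ^+ 2) = (j`! ^ 2)%:R - p%:R ^+ 2 * r.
  by rewrite -IHj; ring.
by rewrite natrX; ring.
Qed.

(** * The polynomial G with roots 1, ..., p-1 *)

Definition falling_poly (n : nat) : {poly int} :=
  \prod_(1 <= j < n) ('X - j%:R%:P).

Lemma falling_poly_coef01 (n : nat) :
  (falling_poly n.+1)`_0 = (-1) ^+ n * n`!%:R /\
  ((falling_poly n.+1)`_1)%:~R =
    - ((-1) ^+ n * n`!%:R * \sum_(1 <= j < n.+1) j%:R^-1) :> rat.
Proof.
elim: n => [|n [IH0 IH1]].
  by rewrite /falling_poly !big_geq // !coef1 mulr0 oppr0.
have -> : falling_poly n.+2 = falling_poly n.+1 * ('X - n.+1%:R%:P).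
  by rewrite /falling_poly big_nat_recr.
rewrite !mulrBr !coefB !coefMX !coefMC /= rmorphB rmorphM /= IH0 IH1.
rewrite (big_nat_recr n.+1) //= factS !(natrM _ n.+1) !(exprS _ n).
rewrite rmorphM rmorph_sign !rmorph_nat.
have nz_n : n.+1%:R != 0 :> rat by rewrite pnatr_eq0.
by split; [ring | field; rewrite nat1r].
Qed.

Lemma falling_poly_horner (p : nat) : (0 < p)%N ->
  (falling_poly p).[p%:R] = p.-1`!%:R /\
  (falling_poly p).[- p%:R] = (-1) ^+ p.-1 * (p.-1`! * 'C((2 * p).-1, p))%:R.
Proof.
case: p => // n _; split.
  rewrite /falling_poly horner_prod fact_prod big_nat_rev natr_prod.
  apply: eq_big_nat => j /andP[j1 jn].
  by rewrite hornerXsubC add1n subSS natrB ?(ltnW jn) // opprB addrC subrK.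
have rising m : (m`! * \prod_(1 <= j < n.+1) (m + j) = (m + n)`!)%N.
  elim: n => [|n IHn]; first by rewrite big_geq // muln1 addn0.
  by rewrite big_nat_recr //= mulnA IHn addnS factS mulnC.
have -> : ((n`! * 'C((2 * n.+1).-1, n.+1)) = \prod_(1 <= j < n.+1) (n.+1 + j))%N.
  apply/eqP; rewrite -(eqn_pmul2l (fact_gt0 n.+1)) rising mulnA mulnC.
  rewrite (_ : (2 * n.+1).-1 = n.+1 + n)%N; last by lia.
  by have := bin_fact (leq_addr n n.+1); rewrite addKn => ->.
rewrite /falling_poly horner_prod natr_prod /=.
have -> : (-1) ^+ n = \prod_(1 <= j < n.+1) (-1) :> int.
  by rewrite prodr_const_nat subn1.
rewrite -big_split /=; apply: eq_bigr => j _.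
by rewrite hornerXsubC natrD mulN1r opprD.
Qed.

(** By Fermat, 1, ..., p-1 are p-1 distinct roots of the monic polynomial X^(p-1) - 1. *)
Lemma falling_poly_Fp (p : nat) : prime p ->
  map_poly intr (falling_poly p) = 'X^(p.-1) - 1 :> {poly 'F_p}.
Proof.
move=> p_pr; have p_gt1 := prime_gt1 p_pr.
rewrite /falling_poly rmorph_prod /=.
under eq_bigr do rewrite rmorphB /= map_polyX map_polyC /= rmorph_nat.
pose rs := [seq j%:R : 'F_p | j <- index_iota 1 p].
have -> : \prod_(1 <= j < p) ('X - j%:R%:P) = \prod_(z <- rs) ('X - z%:P) :> {poly 'F_p}.
  by rewrite big_map.
have size_Xn1 : size ('X^(p.-1) - 1 : {poly 'F_p}) = p.
  by rewrite size_XnsubC ?prednK //; lia.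
have nat_Fp_eq0 (j : nat) : (j%:R == 0 :> 'F_p) = (p %| j)%N.
  by rewrite (dvdn_pcharf (pchar_Fp p_pr)).
rewrite [RHS](@all_roots_prod_XsubC _ _ rs).
- by rewrite lead_coefXnsubC ?scale1r //; lia.
- by rewrite size_Xn1 size_map size_iota; lia.
- apply/allP => _ /mapP[j + ->]; rewrite mem_index_iota => /andP[j1 jp].
  rewrite rootE hornerD hornerN hornerXn hornerC subr_eq0; apply/eqP.
  have nz_j : j%:R != 0 :> 'F_p by rewrite nat_Fp_eq0 gtnNdvd.
  apply: (mulfI nz_j); rewrite mulr1 -exprS prednK; last by lia.
  by have := expf_card (j%:R : 'F_p); rewrite card_Fp.
- rewrite uniq_rootsE map_inj_in_uniq ?iota_uniq // => i j.
  rewrite !mem_index_iota => /andP[_ ip] /andP[_ jp] /(congr1 (@nat_of_ord _)).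
  by rewrite !val_Fp_nat // !modn_small.
Qed.

(* Here f is G(p) = G(0), the product with the binomial is G(-p), and the
   linear coefficient is G'(0): combine the Taylor expansions of G at p and -p. *)
Lemma falling_poly_congr (p : nat) : prime p -> (3 < p)%N ->
  let f := p.-1`!%:R : int in
  exists y : int, (falling_poly p)`_1 = p%:R ^+ 2 * y /\ exists z : int,
  f * 'C((2 * p).-1, p)%:R - f + 2 * p%:R * (falling_poly p)`_1 =
    p%:R ^+ 4 * z.
Proof.
move=> p_pr p_gt3 f; set G := falling_poly p.
have p_odd : odd p by have [|//] := even_prime p_pr; lia.
have sgn : (-1) ^+ p.-1 = 1 :> int.
  by rewrite -signr_odd -subn1 oddB ?prime_gt0 // p_odd.
(* So p >= 5, and the indices 2 and 3 lie strictly between 0 and p-1. *)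
have p_neq4 : p != 4 by apply: contraTneq p_pr => ->.
have [Gp GNp] := falling_poly_horner p (prime_gt0 p_pr).
have G0 : G`_0 = f.
  have [+ _] := falling_poly_coef01 p.-1; rewrite prednK ?prime_gt0 // => ->.
  by rewrite sgn mul1r.
have dvd_coef i : (0 < i < p.-1)%N -> exists h, G`_i = p%:R * h.
  move=> /andP[i0 ip]; suff /dvdzP[h ->] : (p %| G`_i)%Z by exists h; rewrite mulrC natz.
  rewrite (dvdz_pcharf (pchar_Fp p_pr)) -[_%:~R](coef_map intr) falling_poly_Fp //.
  by rewrite coefB coefXn coef1 (ltn_eqF ip) (gtn_eqF i0) subrr.
have [h2 Gh2] := dvd_coef 2 ltac:(lia); have [h3 Gh3] := dvd_coef 3 ltac:(lia).
have GE x : G.[x] = f + G`_1 * x + p%:R * h2 * x ^+ 2 + p%:R * h3 * x ^+ 3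
                    + (drop_poly 4 G).[x] * x ^+ 4.
  rewrite -{1}(poly_take_drop 4 G) hornerD hornerM hornerXn; congr (_ + _).
  rewrite (@horner_coef_wide _ 4) ?size_take_poly // !big_ord_recr big_ord0 /=.
  by rewrite !coef_take_poly /= G0 Gh2 Gh3; ring.
have nz_p : p%:R != 0 :> int by rewrite pnatr_eq0; lia.
set R := drop_poly 4 G in GE.
(* Since G(p) = f = G(0), the nonconstant terms at p sum to zero; divide by p. *)
have G1 : G`_1 = p%:R ^+ 2 * - (h2 + p%:R * h3 + p%:R * R.[p%:R]).
  apply: (mulIf nz_p); apply/subr0_eq.
  move: (GE p%:R); rewrite Gp -/f => /esym/eqP; rewrite -subr_eq0 => /eqP E.
  by apply: etrans E; ring.
exists (- (h2 + p%:R * h3 + p%:R * R.[p%:R])); split=> //.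
(* In G(-p) - G(p) the even terms [f] and [h2] cancel, and 2 p G'(0) removes the linear one. *)
exists (- 2 * h3 + R.[- p%:R] - R.[p%:R]).
have -> : f * 'C((2 * p).-1, p)%:R = G.[- p%:R].
  by rewrite GNp sgn mul1r natrM.
have -> : f = G.[p%:R] by rewrite Gp.
rewrite !GE; ring.
Qed.

(** * Wolstenholme's congruence and the comparison of coefficients *)

Lemma coef_sum_scaleXn (R : nzSemiRingType) (c : nat -> R) (m n k : nat) :
  (\sum_(m <= i < n) c i *: 'X^i)`_k = if (m <= k < n)%N then c k else 0.
Proof.
rewrite coef_sum; under eq_bigr do rewrite coefZ coefXn.
case: ifP => [kmn|/negbT kmn].
  rewrite (bigD1_seq k) ?mem_index_iota ?iota_uniq //= eqxx mulr1 big1 ?addr0 //.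
  by move=> i /negPf nik; rewrite eq_sym nik mulr0.
rewrite big_seq big1 // => i; rewrite mem_index_iota => imn.
by case: eqP => [ki|]; rewrite ?mulr0 //; rewrite ki imn in kmn.
Qed.

Lemma coprime_fact (p n : nat) : prime p -> (n < p)%N -> coprime p n`!.
Proof.
move=> p_pr; elim: n => [|n IHn] ltnp; first exact: coprimen1.
by rewrite factS coprimeMr prime_coprime // gtnNdvd // IHn // ltnW.
Qed.

(** Since p^2 divides G'(0), [falling_poly_congr] gives f (W - 1) = p^3 (p z - 2 y), and f = (p-1)!
    is prime to p. *)
Lemma Wolstenholme (p : nat) : prime p -> (3 < p)%N ->
  exists w : int, 'C((2 * p).-1, p)%:R - 1 = p%:R ^+ 3 * w.
Proof.
move=> p_pr p_gt3.
have [y [g1E [z fWE]]] := falling_poly_congr p p_pr p_gt3.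
suff /dvdzP[w ->] : (p%:Z ^+ 3 %| 'C((2 * p).-1, p)%:R - 1)%Z.
  by exists w; rewrite mulrC natz.
have co : coprimez (p%:Z ^+ 3) p.-1`!%:Z.
  by rewrite coprimezE abszX !absz_nat coprimeXl ?coprime_fact // prednK ?prime_gt0.
rewrite -(Gauss_dvdzr _ co); apply/dvdzP; exists (p%:R * z - 2 * y).
move: fWE; rewrite g1E -!natz => /(canRL (addrK _)).
by rewrite mulrBr mulr1 => ->; ring.
Qed.

Theorem theorem6p2 (p : nat) (p_prime : prime p) (p_gt3 : (3 < p)%N) :
  polyQ_congr p 2
    (p%:R *: \sum_(1 <= k < p)
       ((k%:R ^+ 3 * 'C(2 * k, k)%:R : rat)^-1 *: 'X^k))
    ((p%:R ^- 2 : rat) *: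
       (1 - ('C(2 * p, p)%:R : rat)^-1 *: (lucas_at p (2%:R - 'X) + 'X^p))
     - (p%:R^-1 : rat) *:
       \sum_(1 <= k < p) ((k%:R : rat)^-1 *: lucas_at k (2%:R - 'X))).
Proof.
have p_odd : odd p by have [|//] := even_prime p_prime; lia.
have p_gt0 := prime_gt0 p_prime.
set W := 'C((2 * p).-1, p).
have [w WE] := Wolstenholme p p_prime p_gt3.
have co_f : coprime p p.-1`! by rewrite coprime_fact ?prednK.
have co_W : coprime p W.
  rewrite prime_coprime //; apply/negP => pW.
  have : (p%:Z %| W%:Z - (W%:R - 1))%Z.
    by rewrite rpredB // WE !natz exprS -mulrA dvdz_mulr.
  by rewrite natz opprB addrC subrK dvdz1 absz_nat; lia.
have nz_P : p%:R != 0 :> rat by rewrite pnatr_eq0; lia.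
have nz_W : W%:R != 0 :> rat.
  by rewrite pnatr_eq0 /W -lt0n bin_gt0; lia.
have nz_f n : n`!%:R != 0 :> rat by rewrite pnatr_eq0 -lt0n fact_gt0.
have {}WE : W%:R - 1 = p%:R ^+ 3 * w%:~R :> rat.
  by move/(congr1 (intr : int -> rat)): WE; rewrite rmorphB rmorphM rmorphXn /= !rmorph_nat.
have -> : 'C(2 * p, p)%:R = 2 * W%:R :> rat.
  apply: (mulfI nz_P); rewrite -!natrM; congr _%:R.
  by rewrite [RHS]mulnA [(p * 2)%N]mulnC mul_bin_down; congr (_ * _)%N; lia.
set A := _ *: _; set B := _ - _.
exists (p%:R ^- 2 *: (A - B)); last first.
  by rewrite scalerA mulfV ?scale1r // expf_neq0.
rewrite qualifE /=; apply/(all_nthP 0) => k _; rewrite coefZ coefB coefZ coef_sum_scaleXn coefB !coefZ.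
rewrite coefB coef1 coefZ coefD coefXn coef_lucas_at.
case: k => [|j].
  have [y [g1E [z fWE]]] := falling_poly_congr p p_prime p_gt3.
  have [_] := falling_poly_coef01 p.-1; rewrite prednK // -signr_odd.
  rewrite -subn1 oddB // p_odd expr0 !mul1r subn1 g1E rmorphM rmorphXn /= rmorph_nat => fH.
  move/(congr1 (intr : int -> rat)): fWE; rewrite g1E.
  rewrite !(rmorph_nat, rmorphXn, rmorphB, rmorphD, rmorphM) /= -/W => fWE.
  (* Multiplied by f W, the constant coefficient becomes -(z + 2 y (W - 1) / p), where W - 1 = p^3
     w. *)
  apply: (@Zloc_frac _ _ (- (z + 2 * p%:R ^+ 2 * y * w)) (p.-1`! * W)).
    by rewrite coprimeMr co_f.
  have -> : (\sum_(1 <= i < p) (i%:R^-1 *: lucas_at i (2%:R - 'X)))`_0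
      = 2 * \sum_(1 <= i < p) (i%:R : rat)^-1.
    rewrite coef_sum mulr_sumr; apply: eq_bigr => i _.
    by rewrite coefZ coef_lucas_at muln0 !bin0 mul1r mulrC.
  rewrite (_ : (0 == p)%N = false) ?muln0 ?bin0; last by lia.
  rewrite !(rmorph_nat, rmorphXn, rmorphN, rmorphD, rmorphM) ?natrM /= mulr0n.
  rewrite (_ : \sum_(1 <= i < p) i%:R^-1 = - (p%:R ^+ 2 * y%:~R) / p.-1`!%:R);
    last by rewrite fH opprK mulrAC mulfV ?mul1r.
  rewrite (_ : z%:~R = (p.-1`!%:R * W%:R - p.-1`!%:R + 2 * p%:R * (p%:R ^+ 2 * y%:~R)) / p%:R ^+ 4);
    last by rewrite fWE mulrC mulKf ?expf_neq0.
  rewrite (_ : w%:~R = (W%:R - 1) / p%:R ^+ 3);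
    last by rewrite WE mulrC mulKf ?expf_neq0.
  by field; rewrite nz_P nz_W nz_f.
rewrite coef_sum_lucas_at // (_ : (j.+1 == 0)%:R = 0) // (_ : (1 <= j.+1 < p)%N = (j.+1 < p)%N) //.
have [lt_jp|ge_jp|eq_jp] := ltngtP j.+1 p; last first.
(* For k = p the leading coefficient (-1)^p = -1 of v_p(2-t) cancels t^p. *)
- rewrite eq_jp (_ : p + p = 2 * p)%N; last by lia.
  rewrite binn (@bin_small (2 * p).-1); last by lia.
  rewrite -[(-1) ^+ p]signr_odd p_odd.
  apply: (@Zloc_frac _ _ 0 1%N); first exact: coprimen1.
  by rewrite expr1 !(mulr0, addr0, mulr1, addNr, subr0).
- apply: (@Zloc_frac _ _ 0 1%N); first exact: coprimen1.
  rewrite !bin_small; try lia.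
  by rewrite !(mulr0, addr0, mulr1, addNr, subr0).
have [r rE] := prod_sub_sqr p j.
have Q := falling_fact_symm p j (ltnW lt_jp).
set R := \prod_(1 <= i < j.+1) _ in rE.
have RE : \prod_(1 <= i < j.+1) (i%:R ^+ 2 - p%:R ^+ 2) = R%:~R :> rat.
  rewrite rmorph_prod; apply: eq_bigr => i _.
  by rewrite !(rmorphB, rmorph_nat, rmorphXn).
rewrite {}RE in Q.
have {rE} : j`!%:R ^+ 2 - R%:~R = p%:R ^+ 2 * r%:~R :> rat.
  move/(congr1 (intr : int -> rat)): rE.
  by rewrite !(rmorphB, rmorph_nat, rmorphXn, rmorphM) /= ?natrX.
move/esym/(canRL (mulKf (expf_neq0 2 nz_P))) => rE.
move/esym/(canRL (mulKf (expf_neq0 3 nz_P))): WE => wE.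
(* Here m = (2p-1)! / (2k)! with k = j+1 < p, and (2p-1)! = W p! (p-1)!. Thus p / (2k)! = m / (f^2
   W) has a denominator prime to p. *)
have [m mE] : exists m : nat, m%:R = p%:R * p.-1`!%:R ^+ 2 * W%:R / (2 * j.+1)`!%:R :> rat.
  exists ('C((2 * p).-1, 2 * j.+1) * ((2 * p).-1 - 2 * j.+1)`!)%N.
  apply: (canRL (mulfK (nz_f _))); rewrite -natrX -!natrM; congr _%:R.
  rewrite -mulnA [(_`! * (2 * _)`!)%N]mulnC bin_fact; last by lia.
  rewrite -(@bin_fact (2 * p).-1 p); last by lia.
  rewrite (_ : (2 * p).-1 - p = p.-1)%N; last by lia.
  have -> : p`! = (p * p.-1`!)%N by have := factS p.-1; rewrite prednK.
  by rewrite -/W mulnC -mulnn !mulnA.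
have fact2 n : 'C(n, 2 * j.+1)%:R = (n ^_ (2 * j.+1))%:R / (2 * j.+1)`!%:R :> rat.
  by apply: (canRL (mulfK (nz_f _))); rewrite -natrM bin_ffact.
rewrite !fact2.
have -> : 'C(2 * j.+1, j.+1)%:R = (2 * j.+1)`!%:R / (j.+1%:R * j`!%:R) ^+ 2 :> rat.
  apply: (canRL (mulfK _)); first by rewrite expf_neq0 // mulf_neq0 // pnatr_eq0.
  rewrite -natrM -natrX -natrM -factS -(@bin_fact (2 * j.+1) j.+1); last by lia.
  by rewrite (_ : 2 * j.+1 - j.+1 = j.+1)%N ?mulnn; last by lia.
(* Both falling factorials are the symmetric product (p+j)...(p-j) times one extra factor, p + k or
   p - k. *)
have -> : (p + j.+1) ^_ (2 * j.+1) = ((p + j.+1) * (p + j) ^_ (2 * j).+1)%N.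
  by rewrite addnS -ffactSS mulnS.
have -> : (p + j.+1).-1 ^_ (2 * j.+1) = ((p + j) ^_ (2 * j).+1 * (p - j.+1))%N.
  rewrite addnS (_ : 2 * j.+1 = (2 * j).+2)%N; last by lia.
  by rewrite ffactnSr /=; congr (_ * _)%N; lia.
rewrite (natrM _ (p + j.+1)) (natrM _ (_ ^_ _)) Q natrB ?(ltnW lt_jp) // natrD (exprS _ j).
move: (nz_f (2 * j.+1)%N) mE; move: (2 * j.+1)`!%:R => F nz_F mE.
(* After division by p^2 the coefficient is p (r + k R w / W) / (k (2k)!). One factor W clears w /
   W, the other comes with f^2 from replacing p / (2k)! through m. *)
apply: (@Zloc_frac _ _ ((r * W%:R + R * j.+1%:R * w) * m%:R) (W * j.+1 * (p.-1`! * p.-1`!) * W)).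
  by rewrite !coprimeMr co_W co_f prime_coprime // gtnNdvd.
rewrite !natrM !(rmorph_nat, rmorphD, rmorphM) /= rE wE mE mulr0n addr0.
have nz_k : j.+1%:R != 0 :> rat by rewrite pnatr_eq0.
move: (j.+1%:R) nz_k => k nz_k.
have nz_q := nz_f j.
rewrite -signr_odd; by case: (odd j); field; rewrite nz_P nz_F nz_k nz_W nz_q.
Qed.
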